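(* The ternary Cantor set $T_\ell$ of length $\ell$ has magnitude given by $$|T_\ell|=1+\sum_{i=1}^\infty 2^{i-1}\tanh\biggl(\frac{\ell}{2\cdot 3^i}\biggr).$$
   Context: For $\ell>0$, the length $\ell$ ternary Cantor set $T_\ell\subset[0,\ell]$ is the intersection $\bigcap_{j\ge 0}T_{\ell,j}$, where $T_{\ell,0}=[0,\ell]$ and $T_{\ell,j}$ is obtained from $T_{\ell,j-1}$ by removing the open middle third of each maximal subinterval; it carries the metric induced from $\mathbb{R}$. A weight measure on a metric space $(X,d)$ is a finite signed Borel measure $\nu$ on $X$ such that $\int_{x\in X}e^{-d(x,y)}\,d\nu(x)=1$ for all $y\in X$. If a weight measure $\nu$ exists on $X$, the magnitude of $X$ is defined to be its total mass $|X|:=\nu(X)$ (which does not depend on the choice of weight measure). *)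

(* Defs.v *)
From HB Require Import structures.
From mathcomp Require Import all_boot all_order all_algebra.
From mathcomp Require Import all_classical all_reals all_analysis.

Set Implicit Arguments.
Unset Strict Implicit.
Unset Printing Implicit Defensive.

Import Order.TTheory GRing.Theory Num.Theory.
Import numFieldNormedType.Exports.

Local Open Scope classical_set_scope.
Local Open Scope ring_scope.

Section subset_metric.
Context {R : realType} {X : metricType R} (A : set X).

Let dist (x y : set_type A) : R := mdist (set_val x) (set_val y).

Let dist_ge0 x y : 0 <= dist x y.
Proof. exact: mdist_ge0. Qed.

Let dist_positivity x y : dist x y = 0 -> x = y.
Proof. by move/mdist_positivity/val_inj. Qed.

Let ballEdist x d : ball x d = [set y | dist x y < d].
Proof.
by apply/seteqP; split => y; rewrite /ball/= /initial_ball ballEmdist.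
Qed.

(* The topology on set_type A is the one already put there by the library;
   only the induced distance is added. *)
HB.instance Definition _ := @PseudoMetric_isMetric.Build R (set_type A)
  dist dist_ge0 dist_positivity ballEdist.

End subset_metric.

(* The library's measurable spaces are pointed types. The base point plays no
   role below: it only says that the space is nonempty. *)
#[short(type="pmetricType")]
HB.structure Definition PointedMetric (K : numDomainType) :=
  {M of Pointed M & Metric K M}.

Notation borel X := (g_sigma_algebraType (@open X)).

Section charge_integral.
Context d (T : measurableType d) (R : realType).
Variable nu : {charge set T -> \bar R}.

Lemma hahn_pair_exists :
  exists PN : set T * set T, hahn_decomposition nu PN.1 PN.2.
Proof. by have [P [N PN]] := Hahn_decomposition nu; exists (P, N). Qed.

(* The integral does not depend on which Hahn decomposition is chosen. *)
Definition hahn_pairP := svalP (cid hahn_pair_exists).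

Definition charge_integral (f : T -> \bar R) : \bar R :=
  (\int[jordan_pos hahn_pairP]_x f x - \int[jordan_neg hahn_pairP]_x f x)%E.

End charge_integral.

Section magnitude.
Context {R : realType} (X : pmetricType R).

Definition weight_measure (nu : {charge set (borel X) -> \bar R}) : Prop :=
  forall y : X, charge_integral nu (fun x => (expR (- mdist (x : X) y))%:E) = 1%E.

Definition has_magnitude (m : \bar R) : Prop :=
  (exists nu, weight_measure nu) /\
  (forall nu, weight_measure nu -> nu setT = m).

End magnitude.

Section ternary_cantor.
Context {R : realType}.
Implicit Types (A : set R) (a b l : R).

Definition maximal_subinterval A a b : Prop :=
  [/\ a <= b, `[a, b] `<=` A &
      forall J : set R, is_interval J -> `[a, b] `<=` J -> J `<=` A ->
        J = `[a, b]%classic].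

Definition remove_middle_thirds A : set R :=
  A `\` \bigcup_(I in [set I : R * R | maximal_subinterval A I.1 I.2])
          `](2 * I.1 + I.2) / 3, (I.1 + 2 * I.2) / 3[%classic.

Definition cantor_stage l (j : nat) : set R :=
  iter j remove_middle_thirds `[0, l]%classic.

(* R^o is the copy of R carrying the metric |x - y| *)
Definition ternary_cantor l : set R^o := \bigcap_j cantor_stage l j.

Lemma cantor_stage0 l j : 0 <= l ->
  cantor_stage l j 0 /\ cantor_stage l j `<=` `[0, l].
Proof.
move=> l0; elim: j => [|j [IH0 IHl]]; first by split; rewrite //= in_itv/= lexx.
split; last by move=> x [/IHl].
split=> //; move=> [[a b] [/= ab abA _]]; rewrite in_itv/= => /andP[ab0 _].
have /IHl : cantor_stage l j a by apply: abA; rewrite /= in_itv/= lexx.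
rewrite /= in_itv/= => /andP[a0 _].
move: ab0; rewrite ltNge => /negP; apply.
by rewrite divr_ge0// addr_ge0 ?mulr_ge0// (le_trans a0).
Qed.

Lemma ternary_cantor0 l : 0 <= l -> 0 \in ternary_cantor l.
Proof. by move=> l0; apply/mem_set => j _; exact: (cantor_stage0 j l0).1. Qed.

Definition cantor_type (l : {posnum R}) : Type := ternary_cantor l%:num.

HB.instance Definition _ (l : {posnum R}) :=
  Metric.copy (cantor_type l) (set_type (ternary_cantor l%:num)).
HB.instance Definition _ (l : {posnum R}) :=
  isPointed.Build (cantor_type l)
    (SigSub (ternary_cantor0 (ltW (gt0 l)))).

Definition tanh (x : R) : R :=
  (expR x - expR (- x)) / (expR x + expR (- x)).

End ternary_cantor.

(* Main.v *)
Require Import Defs.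
From HB Require Import structures.
From mathcomp Require Import all_boot all_order all_algebra.
From mathcomp Require Import all_classical all_reals all_analysis.
From mathcomp Require Import measurable_realfun.
From mathcomp Require Import ring lra.

Import Order.TTheory GRing.Theory Num.Theory.
Import numFieldNormedType.Exports.

Local Open Scope classical_set_scope.
Local Open Scope ring_scope.

(** The weight measure of the Cantor set T of length l is explicit and purely
atomic. For a finite subset of the line the weight of a point is
(tanh (g / 2) + tanh (g' / 2)) / 2, where g and g' are the distances to its two
neighbours (a missing neighbour counts as infinitely far). As T has Lebesgue
measure zero, the same recipe applied to its gaps gives its whole weight
measure: mass 1/2 at 0 and at l, and mass tanh (g / 2) / 2 at both ends of each
bounded gap of width g. There are 2^(i-1) gaps of width l / 3^i, so the total
mass is 1 + sum_i 2^(i-1) tanh (l / (2 * 3^i)).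

That the potential of this measure is 1 on T is seen by comparison with an
interval. The weight measure of [0, d] is half of Lebesgue measure on it plus
mass 1/2 at both ends; let u_d be the potential of the Lebesgue part.
Cutting [0, 3d] into its thirds gives, away from the open middle third,
u_(3d)(z) = u_d(z) + u_d(z - 2d) + the potential of the two atoms at the ends of
the middle third (interior_potential_thirds). Summed over the 2^n intervals of
the n-th stage this telescopes: on T the atoms of the first n levels have
potential 1 minus the sum of 2^n functions u_d with d = l / 3^n
(sum_level_potential). Since 0 <= u_d <= d / 2, the error is at most
(2/3)^n * l / 2, which tends to 0. The intervals of each stage are found by
showing that they are exactly its maximal subintervals
(maximal_subinterval_stage_cover), which uses that two of them are at least
their own length apart (left_ends_spaced).

It remains that every weight measure nu has this mass. Integrate the identity
sum_k w_k e^(-d(x_k, y)) = 1 with respect to nu in the variable y: each atom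
contributes w_k because nu is a weight measure, so nu(T) = sum_k w_k. The
exchange of sum and integral is done separately for the two Jordan parts of nu,
where all the terms are nonnegative (weight_mass_atomic). *)

(** * Integrating against a positive charge *)

Section charge_integral_lemmas.
Context d (T : measurableType d) (R : realType).


Variable mu : {finite_measure set T -> \bar R}.

(** On a negative set a measure is both nonpositive and nonnegative, hence zero,
whichever Hahn decomposition was chosen. *)
Lemma jordan_neg_finite_measure (P N A : set T)
    (PN : hahn_decomposition (charge_of_finite_measure mu) P N) :
  measurable A -> jordan_neg PN A = 0%E.
Proof.
move=> mA; have [_ [mN negN] _ _] := PN.
rewrite jordan_negE cjordan_negE /crestr0 mem_set// /crestr.
rewrite -[LHS]/(- mu (A `&` N))%E; suff -> : mu (A `&` N) = 0%E by rewrite oppe0.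
apply/eqP; rewrite eq_le measure_ge0 andbT.
by apply: negN; [exact: measurableI|exact: subIsetr].
Qed.

Lemma jordan_pos_finite_measure (P N A : set T)
    (PN : hahn_decomposition (charge_of_finite_measure mu) P N) :
  measurable A -> jordan_pos PN A = mu A.
Proof.
move=> mA.
have -> : (mu A = jordan_pos PN A - jordan_neg PN A)%E.
  rewrite -[LHS]/(charge_of_finite_measure mu A) (jordan_decomp PN mA).
  by rewrite /cadd/= cscaleN1.
by rewrite jordan_neg_finite_measure// sube0.
Qed.

Lemma charge_integral_finite_measure (f : T -> \bar R) :
  charge_integral (charge_of_finite_measure mu) f = (\int[mu]_x f x)%E.
Proof.
rewrite /charge_integral; set PN := hahn_pairP _.
rewrite (_ : (\int[jordan_neg PN]_x f x)%E = 0%E); last first.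
  rewrite -(integral_measure_zero setT f).
  by apply: eq_measure_integral => A mA _; exact: jordan_neg_finite_measure.
rewrite sube0; apply: eq_measure_integral => A mA _.
exact: jordan_pos_finite_measure.
Qed.

End charge_integral_lemmas.

(** * Measurability of the similarity kernel *)

Section exp_dist.
Context {R : realType} (X : pmetricType R).

(** The preimages of the rays below r are open balls, and those rays generate the
Borel sets of the line. *)
Lemma mdist_measurable (y : X) :
  measurable_fun [set: borel X] (fun x : borel X => mdist (x : X) y).
Proof.
apply: (measurability _ (RGenInftyO.measurableE R)) => _ [_ [r ->] <-].
apply: sub_sigma_algebra; rewrite setTI.
have -> : (fun x : borel X => mdist (x : X) y) @^-1` `]-oo, r[ = ball y r.
  by rewrite ballEmdist; apply/seteqP; split => x /=; rewrite in_itv/= metric_sym.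
rewrite openE => x; rewrite ballEmdist /= => yx.
rewrite /interior -nbhs_ballE; exists (r - mdist y x); rewrite /= ?subr_gt0//.
move=> z; rewrite !ballEmdist /= => xz.
by rewrite (le_lt_trans (metric_triangle _ x _))// addrC -ltrBrDr.
Qed.

Lemma exp_dist_measurable (y : X) :
  measurable_fun [set: borel X]
    (fun x : borel X => (expR (- mdist (x : X) y))%:E).
Proof.
have mN := measurable_funN (mdist_measurable y).
apply/(measurable_EFinP setT).
exact: (measurableT_comp (@measurable_expR R) mN).
Qed.

End exp_dist.

(** * Countably many atoms as a weight measure *)

Section atomic_measure.
Context {R : realType} (X : pmetricType R).
Variables (w : nat -> {nonneg R}) (p : nat -> seq X).

(** The atoms come in finite levels, all the atoms of a level having the same
weight; this matches the levels of gaps of a Cantor set and leaves only a single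
infinite sum. *)
Definition level_measure (n : nat) : {measure set (borel X) -> \bar R} :=
  msum (fun k => mscale (w n) (dirac (nth point (p n) k : borel X)))
    (size (p n)).

Definition atomic_measure : {measure set (borel X) -> \bar R} :=
  mseries level_measure 0.

Lemma ge0_integral_atomic_measure (f : X -> R) :
  measurable_fun [set: borel X] (fun x : borel X => (f x)%:E) ->
  (forall x, 0 <= f x) ->
  (\int[atomic_measure]_(x in [set: borel X]) (f x)%:E =
   \sum_(0 <= n <oo) ((w n)%:num * \sum_(x <- p n) f x)%:E)%E.
Proof.
move=> mf f0; have f0' (x : borel X) : (0 <= (f x)%:E)%E by rewrite lee_fin.
rewrite ge0_integral_measure_series//; apply: eq_eseriesr => n _.
rewrite ge0_integral_measure_sum// (big_nth point) big_mkord mulr_sumr -sumEFin.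
apply: eq_bigr => k _.
by rewrite ge0_integral_mscale// integral_dirac// diracT mul1e.
Qed.

Lemma atomic_measureT :
  (atomic_measure setT = \sum_(0 <= n <oo) ((w n)%:num * (size (p n))%:R)%:E)%E.
Proof.
rewrite -[LHS]mul1e -integral_cst//.
rewrite (ge0_integral_atomic_measure (fun=> 1)) //.
by apply: eq_eseriesr => n _; rewrite big_const_seq count_predT iter_addr_0.
Qed.

Hypothesis w_p_potential : forall y : X,
  (\sum_(0 <= n <oo)
    ((w n)%:num * \sum_(x <- p n) expR (- mdist x y))%:E = 1)%E.

(** Integrating the constant potential 1 against mu recovers the mass of mu from
its potentials at the atoms. For a positive mu this is Tonelli for a sum and an
integral, so mu may have infinite mass. *)
Lemma measureT_of_potentials (mu : {measure set (borel X) -> \bar R}) :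
  (mu setT = \sum_(0 <= n <oo) ((w n)%:num%:E * \sum_(x <- p n)
    \int[mu]_y (expR (- mdist (y : X) x))%:E))%E.
Proof.
have mexp (x : X) := exp_dist_measurable X x.
have exp0 (x : X) (y : borel X) : (0 <= (expR (- mdist (y : X) x))%:E)%E.
  by rewrite lee_fin expR_ge0.
have msum n : measurable_fun [set: borel X]
    (fun y => (\sum_(x <- p n) (expR (- mdist (y : X) x))%:E)%E).
  exact: emeasurable_sum.
have sum0 n (y : borel X) : (0 <= \sum_(x <- p n) (expR (- mdist (y : X) x))%:E)%E.
  by apply: sume_ge0.
rewrite -[LHS]mul1e -integral_cst//.
transitivity (\int[mu]_y (\sum_(0 <= n <oo) ((w n)%:num%:E *
    \sum_(x <- p n) (expR (- mdist (y : X) x))%:E)))%E.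
  apply: eq_integral => y _; rewrite -[LHS](w_p_potential y).
  apply: eq_eseriesr => n _; rewrite EFinM -sumEFin.
  by congr (_ * _)%E; apply: eq_bigr => x _; rewrite metric_sym.
rewrite integral_nneseries//; last 2 first.
- by move=> n; exact: measurable_funeM.
- by move=> n y _; rewrite mule_ge0.
apply: eq_eseriesr => n _.
by rewrite ge0_integralZl_EFin// ge0_integral_sum.
Qed.

(** The Jordan parts P and N of nu have potentials that differ by 1 at every
point. Inserting this in the expression of P(X) through potentials gives the
mass of the atoms plus N(X). *)
Lemma weight_mass_atomic (nu : {charge set (borel X) -> \bar R}) :
  weight_measure nu -> nu setT = atomic_measure setT.
Proof.
move=> nu_weight; set PN := hahn_pairP nu.
pose P : {finite_measure set (borel X) -> \bar R} := jordan_pos PN.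
pose N : {finite_measure set (borel X) -> \bar R} := jordan_neg PN.
have E0 (mu : {measure set (borel X) -> \bar R}) (x : X) :
    (0 <= \int[mu]_y (expR (- mdist (y : X) x))%:E)%E.
  by apply: integral_ge0 => y _; rewrite lee_fin expR_ge0.
have nuE : (nu setT = P setT - N setT)%E.
  by rewrite (jordan_decomp PN measurableT) /cadd/= cscaleN1.
have NT : N setT \is a fin_num by exact: fin_num_measure.
(* N is finite and the kernel is at most 1, so that the potential of N can be
moved across the equality P - N = 1 in the extended reals. *)
have Nfin (x : X) : (\int[N]_y (expR (- mdist (y : X) x))%:E)%E \is a fin_num.
  rewrite ge0_fin_numE//; apply: (@le_lt_trans _ _ (N setT)); last first.
    by rewrite -ge0_fin_numE.
  rewrite -[leRHS]mul1e -integral_cst//; apply: ge0_le_integral => //.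
  - exact: exp_dist_measurable.
  - by move=> y _; rewrite lee_fin -expR0 ler_expR oppr_le0 mdist_ge0.
have PE (x : X) : (\int[P]_y (expR (- mdist (y : X) x))%:E =
    1 + \int[N]_y (expR (- mdist (y : X) x))%:E)%E.
  by rewrite -(nu_weight x) /charge_integral -/PN -/P -/N subeK.
have PT : P setT = (atomic_measure setT + N setT)%E.
  rewrite (measureT_of_potentials P) (measureT_of_potentials N) atomic_measureT.
  rewrite -nneseriesD => [|n _ _|n _ _]; last 2 first.
  - by rewrite lee_fin mulr_ge0.
  - by rewrite mule_ge0// sume_ge0.
  apply: eq_eseriesr => n _; under eq_bigr do rewrite PE.
  rewrite big_split/= ge0_muleDr ?sume_ge0//.
  by rewrite sumEFin big_const_seq count_predT iter_addr_0 EFinM.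
by rewrite nuE PT addeK.
Qed.

Lemma weight_measure_atomic (mu : {finite_measure set (borel X) -> \bar R}) :
  (forall A, mu A = atomic_measure A) ->
  weight_measure (charge_of_finite_measure mu).
Proof.
move=> muE y; rewrite charge_integral_finite_measure.
rewrite (@eq_measure_integral _ _ _ _ atomic_measure); last first.
  by move=> A _ _; exact: muE.
rewrite -[RHS](w_p_potential y).
apply: (ge0_integral_atomic_measure (fun x => expR (- mdist x y))).
  exact: exp_dist_measurable.
by move=> x; exact: expR_ge0.
Qed.

(** Finiteness of the mass is what turns the measure into a charge. *)
Lemma has_magnitude_atomic : (atomic_measure setT < +oo)%E ->
  has_magnitude X (atomic_measure setT).
Proof.
move=> fin; split; last exact: weight_mass_atomic.
have finA : fin_num_fun atomic_measure.
  move=> A mA; rewrite ge0_fin_numE//; apply: le_lt_trans fin.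
  by apply: le_measure; rewrite ?inE.
pose mu : {finite_measure set (borel X) -> \bar R} := HB.pack
  (Measure.sort atomic_measure) (Measure_isFinite.Build _ _ _ _ finA).
by exists (charge_of_finite_measure mu); exact: weight_measure_atomic.
Qed.

End atomic_measure.

(** * The stages of the ternary Cantor set *)

Section cantor_stages.
Context {R : realType} (l : R).
Hypothesis l_gt0 : 0 < l.

Definition stage_length (n : nat) : R := l / 3 ^+ n.

(** The stage-n intervals are listed by their left ends. The recursion splits
each interval of the previous stage, as the removal of middle thirds does, rather
than gluing two smaller copies of the whole set. *)
Fixpoint left_ends (n : nat) : seq R :=
  if n is m.+1 then
    left_ends m ++ [seq a + 2 * stage_length n | a <- left_ends m]
  else [:: 0].

Lemma stage_length_gt0 n : 0 < stage_length n.
Proof. by rewrite divr_gt0// exprn_gt0. Qed.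

Lemma stage_lengthS n : stage_length n = 3 * stage_length n.+1.
Proof.
rewrite /stage_length exprS; field.
by rewrite expf_neq0//= pnatr_eq0.
Qed.

Lemma size_left_ends n : size (left_ends n) = (2 ^ n)%N.
Proof.
elim: n => //= n IH.
by rewrite size_cat size_map IH expnS mul2n addnn.
Qed.

Lemma left_endsSP n b : reflect
  (exists2 a, a \in left_ends n & b = a \/ b = a + 2 * stage_length n.+1)
  (b \in left_ends n.+1).
Proof.
apply: (iffP idP) => [|[a aE [->|->]]]; rewrite /= mem_cat.
- case/orP => [bE|/mapP[a aE ->]]; first by exists b => //; left.
  by exists a => //; right.
- by rewrite aE.
- by apply/orP; right; apply/mapP; exists a.
Qed.

(** Stage-n intervals are separated by at least their common length. This is
what makes them maximal, and keeps every middle third clear of the other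
intervals. *)
Lemma left_ends_spaced n a b : a \in left_ends n -> b \in left_ends n ->
  a < b -> a + 2 * stage_length n <= b.
Proof.
elim: n a b => [|n IH] a b.
  by rewrite !inE => /eqP-> /eqP->; rewrite ltxx.
have d0 := stage_length_gt0 n.+1; have dS := stage_lengthS n.
move=> /left_endsSP[a' aE aa'] /left_endsSP[b' bE bb'] ab.
case: (ltgtP a' b') => [/(IH _ _ aE bE)|/(IH _ _ bE aE)|a'b'].
- case: aa' => ?; case: bb' => ?; lra.
- case: aa' => ?; case: bb' => ?; lra.
- case: aa' => ?; case: bb' => ?; lra.
Qed.

Definition stage_cover (n : nat) : set R :=
  [set x | exists2 a, a \in left_ends n & a <= x <= a + stage_length n].

Lemma stage_cover_gapr n a x : a \in left_ends n ->
  a + stage_length n < x < a + 2 * stage_length n -> ~ stage_cover n x.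
Proof.
move=> aE /andP[ax xa] [b bE /andP[bx xb]].
have d0 := stage_length_gt0 n.
case: (ltgtP a b) => [/(left_ends_spaced _ _ _ aE bE)|/(left_ends_spaced _ _ _ bE aE)|ab]; lra.
Qed.

Lemma stage_cover_gapl n a x : a \in left_ends n ->
  a - stage_length n < x < a -> ~ stage_cover n x.
Proof.
move=> aE /andP[ax xa] [b bE /andP[bx xb]].
have d0 := stage_length_gt0 n.
case: (ltgtP a b) => [/(left_ends_spaced _ _ _ aE bE)|/(left_ends_spaced _ _ _ bE aE)|ab]; lra.
Qed.

(** An interval contained in the stage and meeting one of its intervals cannot
leave it: it would enter an adjacent gap, which is at least as long as that
interval. Half of that length past an end is a point of the gap, and serves as
witness when the intruding interval reaches so far. *)
Lemma maximal_subinterval_stage_cover n u v :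
  maximal_subinterval (stage_cover n) u v <->
  u \in left_ends n /\ v = u + stage_length n.
Proof.
have d0 := stage_length_gt0 n.
have coverI a : a \in left_ends n ->
    `[a, a + stage_length n] `<=` stage_cover n.
  by move=> aE x; rewrite /= in_itv /=; exists a.
split=> [[uv uvA uvmax]|[uE ->]].
- have [a aE /andP[au ua]] : stage_cover n u.
    by apply: uvA; rewrite /= in_itv/= lexx.
  have va : v <= a + stage_length n.
    rewrite leNgt; apply/negP => av.
    have [va|va] := leP v (a + 3 / 2 * stage_length n).
      apply: (@stage_cover_gapr n a v aE); first by apply/andP; split; lra.
      by apply: uvA; rewrite /= in_itv/= lexx uv.
    apply: (@stage_cover_gapr n a (a + 3 / 2 * stage_length n) aE).
      by apply/andP; split; lra.
    by apply: uvA; rewrite /= in_itv/=; apply/andP; split; lra.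
  have E : `[a, a + stage_length n]%classic = `[u, v]%classic.
    apply: uvmax; [exact: interval_is_interval| |exact: coverI].
    by move=> x; rewrite /= !in_itv/= => /andP[? ?]; apply/andP; split; lra.
  have : `[u, v]%classic a by rewrite -E /= in_itv/= lexx; lra.
  have : `[u, v]%classic (a + stage_length n) by rewrite -E /= in_itv/= lexx; lra.
  rewrite /= !in_itv/= => /andP[_ h1] /andP[h2 _].
  have ua' : u = a by lra.
  by rewrite ua'; split => //; lra.
- split; [lra|exact: coverI|move=> J Jitv uJ JA].
  have Ju : J u by apply: uJ; rewrite /= in_itv/= lexx; lra.
  have Jv : J (u + stage_length n) by apply: uJ; rewrite /= in_itv/= lexx; lra.
  apply/seteqP; split => // x Jx; rewrite /= in_itv/=; apply/andP; split.
    rewrite leNgt; apply/negP => xu.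
    have [xu'|xu'] := leP x (u - stage_length n / 2).
      apply: (@stage_cover_gapl n u (u - stage_length n / 2) uE).
        by apply/andP; split; lra.
      by apply/JA/(Jitv _ _ Jx Ju); apply/andP; split; lra.
    apply: (@stage_cover_gapl n u x uE); last exact: JA.
    by apply/andP; split; lra.
  rewrite leNgt; apply/negP => xu.
  have [xu'|xu'] := leP (u + 3 / 2 * stage_length n) x.
    apply: (@stage_cover_gapr n u (u + 3 / 2 * stage_length n) uE).
      by apply/andP; split; lra.
    by apply/JA/(Jitv _ _ Jv Jx); apply/andP; split; lra.
  apply: (@stage_cover_gapr n u x uE); last exact: JA.
  by apply/andP; split; lra.
Qed.

Lemma remove_middle_thirds_stage_cover n :
  remove_middle_thirds (stage_cover n) = stage_cover n.+1.
Proof.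
have d0 := stage_length_gt0 n.+1; have dS := stage_lengthS n.
apply/seteqP; split => x.
- case=> [[a aE /andP[ax xa]] xN].
  have : ~ (a + stage_length n.+1 < x < a + 2 * stage_length n.+1).
    move=> /andP[h1 h2]; apply: xN; exists (a, a + stage_length n) => /=.
      exact/maximal_subinterval_stage_cover.
    by rewrite in_itv/=; apply/andP; split; lra.
  move=> /negP; rewrite negb_and -!leNgt => /orP[xa'|xa'].
    by exists a; [apply/left_endsSP; exists a => //; left|rewrite ax].
  exists (a + 2 * stage_length n.+1); last by rewrite xa'; lra.
  by apply/left_endsSP; exists a => //; right.
- case=> b /left_endsSP[a aE ba] /andP[bx xb]; split.
    by exists a => //; case: ba => ?; apply/andP; split; lra.
  case=> [[u v]] /= /maximal_subinterval_stage_cover[uE ->].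
  rewrite in_itv/= => /andP[h1 h2].
  case: (ltgtP a u) => [/(left_ends_spaced _ _ _ aE uE)|/(left_ends_spaced _ _ _ uE aE)|au];
    case: ba => ?; lra.
Qed.

Lemma cantor_stageE n : cantor_stage l n = stage_cover n.
Proof.
elim: n => [|n IH]; last first.
  by rewrite -remove_middle_thirds_stage_cover -IH.
apply/seteqP; split => x; rewrite /cantor_stage /= in_itv/=.
  by exists 0; rewrite ?inE// /stage_length expr0 divr1 add0r.
by case=> a; rewrite inE => /eqP->; rewrite /stage_length expr0 divr1 add0r.
Qed.

Lemma left_endsS n a : a \in left_ends n -> a \in left_ends n.+1.
Proof. by move=> aE; apply/left_endsSP; exists a => //; left. Qed.

(** As the stages decrease, it is enough to control all the late ones. *)
Lemma ternary_cantor_of_late_stages x n :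
  (forall k, stage_cover (n + k) x) -> ternary_cantor l x.
Proof.
move=> xn j _; have {xn} : cantor_stage l (n + j) x by rewrite cantor_stageE.
by elim: n => // n IH [/IH].
Qed.

(** A left end remains a left end at all later stages. *)
Lemma left_ends_cantor n a : a \in left_ends n -> ternary_cantor l a.
Proof.
move=> aE; apply: (@ternary_cantor_of_late_stages _ n) => k; exists a; last first.
  by rewrite lexx/= lerDl ltW// stage_length_gt0.
elim: k => [|k IH]; first by rewrite addn0.
by rewrite addnS; exact: left_endsS.
Qed.

(** A right end remains a right end at all later stages, now of the last third of
the interval. *)
Lemma right_ends_cantor n a :
  a \in left_ends n -> ternary_cantor l (a + stage_length n).
Proof.
move=> aE; apply: (@ternary_cantor_of_late_stages _ n) => k.
suff [b bE ->] : exists2 b, b \in left_ends (n + k) &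
    a + stage_length n = b + stage_length (n + k).
  by exists b; rewrite // lexx andbT lerDl ltW// stage_length_gt0.
elim: k => [|k [b bE ->]]; first by exists a; rewrite addn0.
exists (b + 2 * stage_length (n + k.+1)).
  by rewrite addnS; apply/left_endsSP; exists b => //; right.
by rewrite addnS stage_lengthS; lra.
Qed.

Lemma cantor_avoids_middle x n a : ternary_cantor l x -> a \in left_ends n ->
  ~ (a + stage_length n.+1 < x < a + 2 * stage_length n.+1).
Proof.
move=> /(_ n.+1 Logic.I); rewrite cantor_stageE => -[b bE /andP[bx xb]] aE /andP[h1 h2].
have d0 := stage_length_gt0 n.+1.
have aE' : a \in left_ends n.+1 by exact: left_endsS.
case: (ltgtP a b) => [/(left_ends_spaced _ _ _ aE' bE) ab| |]; lra.
Qed.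

End cantor_stages.

(** * Potentials of intervals *)

Section potentials.
Context {R : realType}.
Implicit Types d z : R.

(** This form is rational in exp (- d), which is what the potentials of the ends
of a gap of width d are made of. *)
Lemma tanh_half d : tanh (d / 2) = (1 - expR (- d)) / (1 + expR (- d)).
Proof.
rewrite /tanh; have -> : - d = - (d / 2) + - (d / 2) by lra.
rewrite expRD expRN; have := expR_gt0 (d / 2); set e := expR _ => e0.
field; rewrite !gt_eqF//= ?addr_gt0// ?mulr_gt0//.
Qed.

Lemma tanh_half_ge0 d : 0 <= d -> 0 <= tanh (d / 2).
Proof.
move=> d0; rewrite tanh_half; apply: divr_ge0.
  by rewrite subr_ge0 -expR0 ler_expR oppr_le0.
by rewrite addr_ge0// expR_ge0.
Qed.

(** The potential of the weight measure of [0, d], which is exp of minus the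
distance to [0, d]. *)
Definition interval_potential d z : R :=
  if z < 0 then expR z else if d < z then expR (d - z) else 1.

(** The weight measure of [0, d] has mass 1/2 at both ends; without them, half of
Lebesgue measure on [0, d] remains, and this is its potential. *)
Definition interior_potential d z : R :=
  interval_potential d z - (expR (- `|z|) + expR (- `|z - d|)) / 2.

Lemma interior_potential_sym d z : 0 <= d ->
  interior_potential d (d - z) = interior_potential d z.
Proof.
move=> d0; rewrite /interior_potential /interval_potential.
have -> : d - z - d = - z by ring.
have -> : d - (d - z) = z by ring.
rewrite normrN (distrC d z) [X in _ - X / 2]addrC; congr (_ - _).
rewrite subr_lt0 ltrDl oppr_gt0.
by case: (ltP z 0) => z0; case: (ltP d z) => // dz; lra.
Qed.

(** By symmetry z may be taken in the left half of the line; the bounds then follow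
from 1 + x <= exp x. *)
Lemma interior_potential_bounds d z : 0 <= d ->
  0 <= interior_potential d z <= d / 2.
Proof.
move=> d0.
wlog zd : z / z <= d / 2 => [wlg|].
  have [zd|dz] := leP z (d / 2); first exact: wlg.
  by rewrite -interior_potential_sym//; apply: wlg; lra.
rewrite /interior_potential /interval_potential.
rewrite (ler0_norm (_ : z - d <= 0)); last lra.
rewrite opprK; have -> : d < z = false by lra.
have [z0|z0] := ltP z 0.
  rewrite ltr0_norm// opprK expRD.
  have ez : 0 <= expR z <= 1 by rewrite expR_ge0 -expR0 ler_expR ltW.
  have ed : 1 - d <= expR (- d) <= 1.
    by rewrite (expR_ge1Dx (- d)) -expR0 ler_expR oppr_le0.
  by nra.
have ez : 1 - z <= expR (- z) <= 1.
  by rewrite (expR_ge1Dx (- z)) -expR0 ler_expR oppr_le0.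
have ed : 1 + (z - d) <= expR (z - d) <= 1.
  by rewrite expR_ge1Dx -expR0 ler_expR; lra.
by rewrite ger0_norm//; lra.
Qed.

(** Writing q for exp (- d), all the kernels centred at d, 2d and 3d are exp z
times a power of q on this side of the gap, so the identity is rational in q and
exp z. *)
Lemma interior_potential_thirds_left d z : 0 < d -> z <= d ->
  interior_potential (3 * d) z =
  interior_potential d z + interior_potential d (z - 2 * d) +
  tanh (d / 2) / 2 * (expR (- `|z - d|) + expR (- `|z - 2 * d|)).
Proof.
move=> d0 zd; rewrite /interior_potential /interval_potential tanh_half.
rewrite (_ : z - 2 * d - d = z - 3 * d); last by ring.
rewrite (ler0_norm (_ : z - d <= 0)) ?(ler0_norm (_ : z - 2 * d <= 0)); [|lra|lra].
rewrite (ler0_norm (_ : z - 3 * d <= 0)); last lra.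
rewrite !opprK.
have -> : 3 * d < z = false by lra.
have -> : z - 2 * d < 0 by lra.
have -> : d < z = false by lra.
have -> : expR (z - d) = expR z * expR (- d) by rewrite -expRD.
have -> : expR (z - 2 * d) = expR z * expR (- d) ^+ 2.
  by rewrite -expRM_natl -expRD; congr expR; ring.
have -> : expR (z - 3 * d) = expR z * expR (- d) ^+ 3.
  by rewrite -expRM_natl -expRD; congr expR; ring.
have q1 : 1 + expR (- d) != 0 by rewrite gt_eqF// addr_gt0// expR_gt0.
by have [z0|z0] := ltP z 0; field.
Qed.

(** Seen from outside the middle third, half of Lebesgue measure on it has the
same potential as its two end atoms. The reflection of [0, 3d] about its centre
exchanges the two sides of the gap and reduces this to the points on the left. *)
Lemma interior_potential_thirds d z : 0 < d -> ~ (d < z < 2 * d) ->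
  interior_potential (3 * d) z =
  interior_potential d z + interior_potential d (z - 2 * d) +
  tanh (d / 2) / 2 * (expR (- `|z - d|) + expR (- `|z - 2 * d|)).
Proof.
move=> d0 /negP; rewrite negb_and -!leNgt => /orP[|dz].
  exact: interior_potential_thirds_left.
rewrite -interior_potential_sym; last lra.
rewrite interior_potential_thirds_left//; last lra.
rewrite -[in RHS](@interior_potential_sym d z) ?(ltW d0)//.
rewrite -[in RHS](@interior_potential_sym d (z - 2 * d)) ?(ltW d0)//.
rewrite (_ : d - (z - 2 * d) = 3 * d - z); last ring.
rewrite (_ : 3 * d - z - 2 * d = d - z); last ring.
rewrite (_ : 3 * d - z - d = 2 * d - z); last ring.
rewrite (distrC _ z) (distrC _ z); ring.
Qed.

End potentials.

(** * The potential of the ends of the gaps *)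

Section cantor_weights.
Context {R : realType} (l : R).
Hypothesis l_gt0 : 0 < l.
Local Notation E := (left_ends l).
Local Notation d := (stage_length l).

(** Level 0 holds the ends of the unbounded gaps, and level n + 1 the ends of the
gaps created at stage n + 1. *)
Definition gap_ends (n : nat) : seq R :=
  if n is m.+1 then
    [seq a + d n | a <- E m] ++ [seq a + 2 * d n | a <- E m]
  else [:: 0; l].

(** The value 1/2 at level 0 is the limit of tanh (g / 2) / 2 for a gap width g
that tends to infinity. *)
Definition gap_weight (n : nat) : R :=
  if n is m.+1 then tanh (d n / 2) / 2 else 1 / 2.

Lemma gap_weight_ge0 n : 0 <= gap_weight n.
Proof.
case: n => [|n] /=; first by rewrite divr_ge0.
by rewrite divr_ge0// tanh_half_ge0// ltW// stage_length_gt0.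
Qed.

Lemma size_gap_ends n : size (gap_ends n.+1) = (2 ^ n.+1)%N.
Proof. by rewrite /= size_cat !size_map size_left_ends expnS mul2n addnn. Qed.

Lemma gap_ends_cantor n x : x \in gap_ends n -> ternary_cantor l x.
Proof.
case: n => [|n].
  have E0 : 0 \in E 0 by rewrite inE.
  rewrite !inE => /orP[/eqP->|/eqP->]; first exact: (left_ends_cantor l l_gt0 0).
  have := right_ends_cantor l l_gt0 0 0 E0.
  by rewrite add0r /stage_length expr0 divr1.
rewrite mem_cat => /orP[] /mapP[a aE ->].
  exact/right_ends_cantor/left_endsS.
by apply: (left_ends_cantor l l_gt0 n.+1); apply/left_endsSP; exists a => //; right.
Qed.

Definition level_potential n y : R :=
  gap_weight n * \sum_(x <- gap_ends n) expR (- `|y - x|).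

(** Passing to the next stage replaces each interval by its outer thirds and two
atoms. Points of the Cantor set are never in a middle third, so the total
potential there is unchanged. *)
Lemma sum_level_potential n y : ternary_cantor l y ->
  \sum_(0 <= k < n.+1) level_potential k y =
  1 - \sum_(a <- E n) interior_potential (d n) (y - a).
Proof.
move=> yT; elim: n => [|n IH].
  rewrite big_nat1 /level_potential /= !big_cons !big_nil subr0 !addr0.
  have /andP[y0 yl] : 0 <= y <= l.
    have := yT 0%N Logic.I.
    by rewrite /cantor_stage /= in_itv.
  rewrite /interior_potential /interval_potential /stage_length expr0 divr1.
  rewrite ltNge y0 ltNge yl /=.
  by move: (expR _) (expR _) => u v; field.
rewrite big_nat_recr//= IH.
rewrite [X in _ = 1 - X]big_cat/= big_map /level_potential [in LHS]big_cat/= !big_map.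
rewrite mulrDr !mulr_sumr.
suff -> : \sum_(a <- E n) interior_potential (d n) (y - a) =
    \sum_(a <- E n) interior_potential (d n.+1) (y - a) +
    \sum_(a <- E n) interior_potential (d n.+1) (y - (a + 2 * d n.+1)) +
    (\sum_(a <- E n) gap_weight n.+1 * expR (- `|y - (a + d n.+1)|) +
     \sum_(a <- E n) gap_weight n.+1 * expR (- `|y - (a + 2 * d n.+1)|)).
  by rewrite /=; ring.
rewrite -!big_split/= big_seq [RHS]big_seq; apply: eq_bigr => a aE.
have dS := stage_lengthS l n.
have yaB c : y - (a + c) = y - a - c by rewrite opprD addrA.
rewrite !yaB dS interior_potential_thirds.
- by rewrite -mulrDr.
- exact: (stage_length_gt0 l l_gt0).
- move=> /andP[h1 h2]; apply: (cantor_avoids_middle l l_gt0 y n a yT aE).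
  by apply/andP; split; lra.
Qed.

(** The error is a sum of 2 ^ n terms, each at most l / (2 * 3 ^ n). *)
Lemma cvg_sum_level_potential y : ternary_cantor l y ->
  (fun n => \sum_(0 <= k < n) level_potential k y) @ \oo --> (1 : R).
Proof.
move=> yT; rewrite -(cvg_shiftS (fun n => \sum_(0 <= k < n) level_potential k y)).
apply: (@squeeze_cvgr _ _ _ _ (fun n => 1 - geometric (l / 2) (2 / 3) n) (cst 1)).
- near=> n; rewrite /= sum_level_potential//.
  have b a : 0 <= interior_potential (d n) (y - a) <= d n / 2.
    by apply: interior_potential_bounds; rewrite ltW// stage_length_gt0.
  apply/andP; split.
    rewrite lerB//; apply: (@le_trans _ _ (\sum_(a <- E n) (d n / 2))).
      by apply: ler_sum => a _; have /andP[] := b a.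
    rewrite big_const_seq count_predT size_left_ends iter_addr_0.
    rewrite -[leLHS]mulr_natl natrX /stage_length expr_div_n.
    by rewrite le_eqVlt; apply/orP; left; apply/eqP; ring.
  rewrite gerBl; apply: sumr_ge0 => a _; by have /andP[] := b a.
- rewrite -[X in _ --> X]subr0; apply: cvgB; first exact: cvg_cst.
  by apply: cvg_geometric; rewrite ger0_norm; lra.
- exact: cvg_cst.
Unshelve. all: by end_near. Qed.

Lemma level_potential_series y : ternary_cantor l y ->
  (\sum_(0 <= n <oo) (level_potential n y)%:E = 1)%E.
Proof.
move=> yT; apply/cvg_lim => //.
rewrite (_ : (fun _ => _) = EFin \o (fun n => \sum_(0 <= k < n) level_potential k y)).
  by apply: cvg_EFin; [exact: nearW|exact: cvg_sum_level_potential].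
by apply/funext => n; rewrite /= sumEFin.
Qed.

End cantor_weights.

(** * The magnitude of the ternary Cantor set *)

Section cantor_magnitude.
Context {R : realType} (l : {posnum R}).
Local Notation T := (ternary_cantor l%:num).
Let l_gt0 : 0 < l%:num := gt0 l.

(** The value outside of the Cantor set is arbitrary: only ends of gaps are used. *)
Definition cantor_point (x : R) : cantor_type l :=
  insubd ((point : cantor_type l) : set_type T) x.

Definition cantor_weight (n : nat) : {nonneg R} :=
  NngNum (gap_weight_ge0 l%:num l_gt0 n).

Definition cantor_atoms (n : nat) : seq (cantor_type l) :=
  map cantor_point (gap_ends l%:num n).

Lemma mdist_cantor_point (x : R) (y : cantor_type l) : T x ->
  mdist (cantor_point x) y = `|set_val (y : set_type T) - x|.
Proof.
(* The distance from x to y on the line unfolds to the norm of y - x. *)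
move=> Tx; rewrite -[LHS]/`|_ - val (cantor_point x)|.
by rewrite /cantor_point val_insubd mem_set.
Qed.

Lemma mdist_cantor_le (x y : cantor_type l) : mdist x y <= l%:num.
Proof.
have itv (z : cantor_type l) : 0 <= set_val (z : set_type T) <= l%:num.
  by have := set_valP (z : set_type T) 0%N Logic.I; rewrite /cantor_stage /= in_itv.
rewrite -[leLHS]/`|set_val (y : set_type T) - set_val (x : set_type T)| ler_norml.
by have := itv x; have := itv y; lra.
Qed.

Lemma cantor_level_potential n (y : cantor_type l) :
  (cantor_weight n)%:num * (\sum_(x <- cantor_atoms n) expR (- mdist x y)) =
  level_potential l%:num n (set_val (y : set_type T)).
Proof.
rewrite /level_potential big_map; congr (_ * _).
rewrite big_seq [RHS]big_seq; apply: eq_bigr => x xE.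
by rewrite mdist_cantor_point//; exact: gap_ends_cantor xE.
Qed.

Lemma cantor_potential (y : cantor_type l) :
  (\sum_(0 <= n <oo) ((cantor_weight n)%:num *
     \sum_(x <- cantor_atoms n) expR (- mdist x y))%:E = 1)%E.
Proof.
under eq_eseriesr do rewrite cantor_level_potential.
by apply: level_potential_series => //; exact: set_valP.
Qed.

(** The diameter is at most l, so the mass is at most exp l times the potential at
any point, which is 1. *)
Lemma cantor_atomic_measure_lty :
  (atomic_measure _ cantor_weight cantor_atoms setT < +oo)%E.
Proof.
rewrite atomic_measureT.
apply: (@le_lt_trans _ _ ((expR l%:num)%:E * 1)%E); last by rewrite mule1 ltry.
(* The base point of the Cantor set serves as the point of evaluation. *)
rewrite -(cantor_potential point) -nneseriesZl; last first.
  by move=> n _; rewrite lee_fin mulr_ge0// sumr_ge0// => x _; exact: expR_ge0.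
apply: lee_nneseries => [n _ _|n _]; first by rewrite lee_fin mulr_ge0.
rewrite -EFinM lee_fin mulrCA ler_wpM2l// mulr_sumr.
rewrite (_ : (size _)%:R = \sum_(x <- cantor_atoms n) 1); last first.
  by rewrite big_const_seq count_predT iter_addr_0.
apply: ler_sum => x _; rewrite -expRD -[leLHS]expR0 ler_expR subr_ge0.
exact: mdist_cantor_le.
Qed.

Lemma cantor_mass :
  (atomic_measure _ cantor_weight cantor_atoms setT =
   1 + \sum_(1 <= i <oo) (2 ^+ i.-1 * tanh (l%:num / (2 * 3 ^+ i)))%:E)%E.
Proof.
rewrite atomic_measureT nneseries_recl//.
congr (_ + _)%E; first by congr EFin; rewrite /= divfK// pnatr_eq0.
apply: congr_lim; apply/funext => n /=; apply: eq_big_nat => i /andP[i1 _].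
congr EFin; case: i i1 => // i _; rewrite size_map size_gap_ends.
have -> : l%:num / (2 * 3 ^+ i.+1) = stage_length l%:num i.+1 / 2.
  by rewrite invfM mulrA mulrAC.
rewrite [LHS]/= natrX exprS; move: (tanh _) => t /=.
by field.
Qed.

End cantor_magnitude.

Theorem theorem4 (R : realType) (l : {posnum R}) :
  has_magnitude (cantor_type l)
    (1 + \sum_(1 <= i <oo)
           (2 ^+ i.-1 * tanh (l%:num / (2 * 3 ^+ i)))%:E)%E.
Proof.
rewrite -cantor_mass.
apply: has_magnitude_atomic; first exact: cantor_potential.
exact: cantor_atomic_measure_lty.
Qed.
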